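(* The automorphism group $\mathrm{Aut}(\mathfrak{U})$ of the symplectic affine polar space $\mathfrak{U}$ consists of all the maps $$Y\ni[a,u]\longmapsto\bigl[\alpha\,\sigma(a)+\eta(\varphi(u),w)+b,\ \varphi(u)+w\bigr]$$ with a nonzero scalar $\alpha\in F$, a scalar $b\in F$, a vector $w\in V$, an automorphism $\sigma$ of $F$, and a $\sigma$-semilinear bijection $\varphi$ of $V$ such that $\eta(\varphi(u_1),\varphi(u_2))=\alpha\,\sigma(\eta(u_1,u_2))$ for all $u_1,u_2\in V$.
   Context: Let $F$ be a commutative field with $\mathrm{char}(F)\neq2$, $m\geq2$, and let $V=F^{2m-2}$ with zero vector $\theta$ and the nondegenerate symplectic form $\eta(x,y)=\sum_{i=1}^{m-1}(x_{2i-1}y_{2i}-x_{2i}y_{2i-1})$. Let $Y=F\oplus V$, with vectors written $[a,u]$, $a\in F$, $u\in V$, and let $\mathfrak{A}$ be the affine space over $Y$ (points: vectors of $Y$; lines: cosets of 1-dimensional subspaces). Put $\rho([a_1,u_1],[a_2,u_2])=\eta(u_1,u_2)-(a_1-a_2)$ and $p_1\sim p_2$ iff $\rho(p_1,p_2)=0$. The symplectic affine polar space $\mathfrak{U}$ has point set $Y$ and as lines exactly those lines $L$ of $\mathfrak{A}$ for which $p_1\sim p_2$ for all $p_1,p_2\in L$; equivalently the lines $[a,u]+\langle[b,w]\rangle$ with $\eta(u,w)=-b$. (It is obtained from the polar space of the nondegenerate symplectic form $\xi([a_1,b_1,u_1],[a_2,b_2,u_2])=a_1b_2-a_2b_1+\eta(u_1,u_2)$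 on $F\oplus F\oplus V$ by deleting the hyperplane polar to the point $\langle[0,1,\theta]\rangle$, identifying $[a,u]$ with $\langle[1,a,u]\rangle$.) An automorphism of $\mathfrak{U}$ is a bijection of the point set which maps the set of lines of $\mathfrak{U}$ onto itself. *)

(* Defs.v *)
From HB Require Import structures.
From mathcomp Require Import all_boot all_order all_algebra.
From mathcomp Require Import boolp classical_sets.

Set Implicit Arguments.
Unset Strict Implicit.
Unset Printing Implicit Defensive.

Import GRing.Theory.
Local Open Scope ring_scope.
Local Open Scope classical_set_scope.

Notation symp_space F m := ('rV[F]_(2 * m - 2)).

(* The first summand is F^o so that Y carries its F-vector space structure. *)
Notation aff_point F m := (F^o * symp_space F m)%type.

(* The 0-based i < m - 1 stands for i + 1 in the 1-based convention, so the
   coordinates 2i - 1 and 2i become 2i and 2i + 1. *)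
Lemma fst_idx_subproof m (i : 'I_(m - 1)) : (2 * i < 2 * m - 2)%N.
Proof. by rewrite -(mulnBr 2 m 1) ltn_mul2l /=. Qed.

Lemma snd_idx_subproof m (i : 'I_(m - 1)) : ((2 * i).+1 < 2 * m - 2)%N.
Proof.
rewrite -(mulnBr 2 m 1); apply: (@leq_trans (2 * i.+1)); first by rewrite mulnS.
by rewrite leq_mul2l /=.
Qed.

Definition fst_idx m (i : 'I_(m - 1)) : 'I_(2 * m - 2) :=
  Ordinal (fst_idx_subproof i).
Definition snd_idx m (i : 'I_(m - 1)) : 'I_(2 * m - 2) :=
  Ordinal (snd_idx_subproof i).

Section SymplecticAffinePolarSpace.
Variables (F : fieldType) (m : nat).
Local Notation V := (symp_space F m).
Local Notation Y := (aff_point F m).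

Definition symp_form (x y : V) : F :=
  \sum_(i < m - 1) (x ord0 (fst_idx i) * y ord0 (snd_idx i)
                    - x ord0 (snd_idx i) * y ord0 (fst_idx i)).

Definition rho (p1 p2 : Y) : F := symp_form p1.2 p2.2 - (p1.1 - p2.1).

Definition adjacent (p1 p2 : Y) : Prop := rho p1 p2 = 0.

Definition affine_lines : set (set Y) :=
  [set L | exists (p : Y) (D : {vspace Y}),
     \dim D = 1%N /\ L = [set p + v | v in [set` D]]].

Definition polar_lines : set (set Y) :=
  [set L | affine_lines L /\
     (forall p1 p2 : Y, L p1 -> L p2 -> adjacent p1 p2)].

Definition polar_aut : set (Y -> Y) :=
  [set f | bijective f /\ [set f @` L | L in polar_lines] = polar_lines].

End SymplecticAffinePolarSpace.

Arguments affine_lines F m : clear implicits.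
Arguments polar_lines F m : clear implicits.
Arguments polar_aut F m : clear implicits.

(* Main.v *)
(** Adjacency determines the fibration of [Y] over [V]: two points have the same
    [V]-component iff they are equal or have no common neighbour.  An
    automorphism, corrected by a translation so as to fix the origin, thus sends
    [(a, u)] to [(H a u, g u)] for some [H] and [g].  As [(a, u)] is adjacent to
    [(a, 0)], [H a u] does not depend on [u], say [H a u = h a], and preservation
    of adjacency becomes [eta (g u) (g v) = h a - h b <-> eta u v = a - b].  Hence
    [h] is additive, [g] is additive by nondegeneracy of [eta], and preservation
    of orthogonality yields [h (k * c) * h 1 = h k * h c]; so [h / h 1] is a field
    automorphism, over which [g] is semilinear. *)
Require Import Defs.
From HB Require Import structures.
From mathcomp Require Import all_boot all_order all_algebra.
From mathcomp Require Import boolp classical_sets.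

Set Implicit Arguments.
Unset Strict Implicit.
Unset Printing Implicit Defensive.

Import GRing.Theory.
Local Open Scope ring_scope.
Local Open Scope classical_set_scope.

(** * The symplectic form: bilinearity, nondegeneracy, surjectivity *)

Section SympForm.
Variables (F : fieldType) (m : nat).
Local Notation V := (symp_space F m).
Implicit Types (x y z : V) (c k l : F).

Lemma symp_formDl x y z : symp_form (x + y) z = symp_form x z + symp_form y z.
Proof.
rewrite /symp_form -big_split; apply: eq_bigr => i _ /=.
by rewrite !mxE !mulrDl opprD addrACA.
Qed.

Lemma symp_formZl k x y : symp_form (k *: x) y = k * symp_form x y.
Proof.
rewrite /symp_form big_distrr; apply: eq_bigr => i _ /=.
by rewrite !mxE -!mulrA -mulrBr.
Qed.

Lemma symp_formC x y : symp_form x y = - symp_form y x.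
Proof.
rewrite /symp_form -sumrN; apply: eq_bigr => i _.
by rewrite opprB; congr (_ - _); apply: mulrC.
Qed.

Lemma symp_formDr x y z : symp_form x (y + z) = symp_form x y + symp_form x z.
Proof. by rewrite symp_formC symp_formDl opprD -!symp_formC. Qed.

Lemma symp_formZr k x y : symp_form x (k *: y) = k * symp_form x y.
Proof. by rewrite symp_formC symp_formZl -mulrN -symp_formC. Qed.

Lemma symp_formNl x y : symp_form (- x) y = - symp_form x y.
Proof. by rewrite -scaleN1r symp_formZl mulN1r. Qed.

Lemma symp_formNr x y : symp_form x (- y) = - symp_form x y.
Proof. by rewrite -scaleN1r symp_formZr mulN1r. Qed.

Lemma symp_form0l y : symp_form 0 y = 0.
Proof. by rewrite -(scale0r 0) symp_formZl mul0r. Qed.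

Lemma symp_form0r y : symp_form y 0 = 0.
Proof. by rewrite symp_formC symp_form0l oppr0. Qed.

Lemma symp_formxx x : symp_form x x = 0.
Proof. by apply: big1 => i _; rewrite mulrC subrr. Qed.

Lemma symp_form_line x y k l :
  symp_form (x + k *: y) (x + l *: y) = (l - k) * symp_form x y.
Proof.
rewrite !symp_formDl !symp_formDr !symp_formZl !symp_formZr !symp_formxx.
by rewrite !mulr0 addr0 add0r (symp_formC y) mulrN -mulrBl.
Qed.

Definition symp_formE := (symp_formDl, symp_formDr, symp_formNl, symp_formNr,
  symp_formZl, symp_formZr, symp_form0l, symp_form0r, symp_formxx).

(** Only the [i]-th summand survives, so pairing with a basis vector isolates the partner
    coordinate. Together with the companion for [fst_idx] this recovers every coordinate of [x] up
    to sign, whence nondegeneracy. *)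
Lemma symp_form_delta_snd x (i : 'I_(m - 1)) :
  symp_form x (delta_mx 0 (snd_idx i)) = x 0 (fst_idx i).
Proof.
rewrite /symp_form (bigD1 i) //= big1 => [|j ji]; rewrite !mxE !eqxx /=.
  rewrite -[fst_idx i == _]val_eqE /= eqn_leq ltnn andbF.
  by rewrite mulr1 mulr0 subr0 addr0.
rewrite -!val_eqE /= eqSS eqn_mul2l /= val_eqE (negbTE ji).
(* The remaining coincidence would equate an even index with an odd one. *)
case: eqP => [/(congr1 odd)|_]; last by rewrite !mulr0 subrr.
by rewrite /= !mul2n !odd_double.
Qed.

Lemma symp_form_delta_fst x (i : 'I_(m - 1)) :
  symp_form x (delta_mx 0 (fst_idx i)) = - x 0 (snd_idx i).
Proof.
rewrite /symp_form (bigD1 i) //= big1 => [|j ji]; rewrite !mxE !eqxx /=.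
  rewrite -[snd_idx i == _]val_eqE /= eqn_leq ltnn.
  by rewrite mulr1 mulr0 sub0r addr0.
rewrite -!val_eqE /= eqn_mul2l /= val_eqE (negbTE ji).
case: eqP => [/(congr1 odd)|_]; last by rewrite !mulr0 subrr.
by rewrite /= !mul2n !odd_double.
Qed.

Lemma idx_cases (j : 'I_(2 * m - 2)) :
  exists i : 'I_(m - 1), j = fst_idx i \/ j = snd_idx i.
Proof.
have jlt : (j./2 < m - 1)%N.
  rewrite ltn_half_double -mul2n (leq_trans (ltn_ord j)) //.
  by rewrite -(mulnBr 2 m 1).
exists (Ordinal jlt); case Ej: (odd j); [right | left]; apply: val_inj => /=;
  by rewrite -[LHS]odd_double_half Ej -mul2n.
Qed.

Lemma symp_form_nondeg x : (forall y, symp_form x y = 0) -> x = 0.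
Proof.
move=> x0; apply/rowP => j; rewrite mxE.
have [i [->|->]] := idx_cases j; first by rewrite -symp_form_delta_snd x0.
by apply: oppr_inj; rewrite -symp_form_delta_fst x0 oppr0.
Qed.

Lemma symp_form_onto x c : x != 0 -> exists y, symp_form x y = c.
Proof.
move=> xN0; have [y xy] : exists y, symp_form x y != 0.
  apply: contrapT => nex; case/eqP: xN0; apply: symp_form_nondeg => y.
  by apply: contrapT => /eqP xy; apply: nex; exists y.
by exists ((c / symp_form x y) *: y); rewrite symp_formZr mulfVK.
Qed.

End SympForm.

(** * Lines, adjacency and the fibration over [V] *)

Section PolarLines.
Variables (F : fieldType) (m : nat).
Local Notation V := (symp_space F m).
Local Notation Y := (aff_point F m).
Implicit Types (p q r d : Y).

Definition adjacency_preserving (f : Y -> Y) :=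
  forall p q, adjacent (f p) (f q) <-> adjacent p q.

Lemma adjacentE (a b : F) (u v : V) :
  adjacent ((a, u) : Y) (b, v) <-> symp_form u v = a - b.
Proof. by rewrite /adjacent /rho /=; split=> [/subr0_eq//|->]; rewrite subrr. Qed.

Lemma adjacent_refl p : adjacent p p.
Proof. by case: p => a u; apply/adjacentE; rewrite symp_formxx subrr. Qed.

Lemma affine_linesP (L : set Y) : affine_lines F m L <->
  exists p d, d != 0 /\ L = [set p + k *: d | k in [set: F]].
Proof.
split=> [[p [D [dimD ->]]]|[p [d [dN0 ->]]]].
  have dN0 : vpick D != 0 by rewrite vpick0 -dimv_eq0 dimD.
  have DE : D = <[vpick D]>%VS.
    by apply/eqP; rewrite eq_sym eqEdim -memvE memv_pick dimD dim_vline dN0.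
  exists p, (vpick D); split=> //; rewrite eqEsubset; split=> x.
    by case=> v /=; rewrite {1}DE => /vlineP[k ->] <-; exists k.
  by case=> k _ <-; exists (k *: vpick D) => //=; rewrite memvZ ?memv_pick.
exists p, <[d]>%VS; rewrite dim_vline dN0; split=> //.
rewrite eqEsubset; split=> x.
  by case=> k _ <-; exists (k *: d) => //=; rewrite memvZ ?memv_line.
by case=> v /= /vlineP[k ->] <-; exists k.
Qed.

(** Take the joining line. Between its points with parameters [k] and [l], the form and the
    difference of first coordinates are both [l - k] times their values at [p] and [q], so [rho]
    vanishes on the whole line. *)
Lemma polar_line_through p q : p != q -> adjacent p q ->
  exists L, [/\ polar_lines F m L, L p & L q].
Proof.
move=> pq adj; exists [set p + k *: (q - p) | k in [set: F]]; split.
- split.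
    by apply/affine_linesP; exists p, (q - p); rewrite subr_eq0 eq_sym.
  move=> _ _ [k _ <-] [l _ <-]; case: p q adj {pq} => [a u] [b v] /adjacentE uv.
  apply/adjacentE; rewrite /= symp_form_line symp_formDr symp_formNr uv.
  rewrite symp_formxx subr0 opprD addrACA subrr add0r -[RHS]mulrBl.
  by rewrite -opprB -(opprB b a) mulrNN.
- by exists 0; rewrite // scale0r addr0.
- by exists 1; rewrite // scale1r addrC subrK.
Qed.

(** Distinct points are adjacent exactly when some polar line contains both, and [f] permutes the
    polar lines. *)
Lemma polar_aut_adjacency f : polar_aut F m f -> adjacency_preserving f.
Proof.
move=> [/bij_inj f_inj fL] p q.
have [->|pq] := eqVneq p q; first by split=> _; apply: adjacent_refl.
split=> adj.
  have fpq : f p != f q by rewrite (inj_eq f_inj).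
  have [L [pL Lp Lq]] := polar_line_through fpq adj.
  move: pL; rewrite -fL => -[L0 [_ L0adj] L0E].
  move: Lp Lq; rewrite -L0E => -[p' Lp' /f_inj pE] [q' Lq' /f_inj qE].
  by apply: L0adj; rewrite -?pE -?qE.
have [L [pL Lp Lq]] := polar_line_through pq adj.
have [_] : polar_lines F m (f @` L) by rewrite -fL; exists L.
by apply; [exists p | exists q].
Qed.

(** A common neighbour [(c, w)] of [(a, u)] and [(b, u)] forces [a - c = b - c]. If [u] and [v]
    differ, nondegeneracy provides [x] pairing with [u - v] to [a - b], which yields a common
    neighbour of [(a, u)] and [(b, v)]. *)
Lemma same_fiberP p q :
  p.2 = q.2 <-> p = q \/ ~ exists r, adjacent p r /\ adjacent q r.
Proof.
case: p q => [a u] [b v] /=; split=> [<-|].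
  have [->|ab] := eqVneq a b; [by left | right].
  move=> [[c w] [/adjacentE uw /adjacentE]]; rewrite uw => /addIr E.
  by rewrite E eqxx in ab.
case=> [[_ ->]//|nex]; apply: contrapT => /eqP uv; apply: nex.
have := uv; rewrite -subr_eq0 => /symp_form_onto-/(_ (a - b))[x xE].
(* The first coordinate is forced by adjacency to [(a, u)]; the choice of [x] then gives adjacency
   to [(b, v)]. *)
exists (a - symp_form u x, x); split; apply/adjacentE.
  by rewrite opprB addrC subrK.
have -> : symp_form v x = symp_form u x - (a - b).
  by rewrite -xE !symp_formE opprB addrC subrK.
by rewrite !opprB addrCA.
Qed.

Lemma adjacency_preserving_fiber f : bijective f -> adjacency_preserving f ->
  forall p q, p.2 = q.2 -> (f p).2 = (f q).2.
Proof.
move=> [f' fK f'K] fadj p q /same_fiberP[->//|nex].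
apply/same_fiberP; right=> -[r]; rewrite -[r]f'K => -[/fadj ? /fadj ?].
by apply: nex; exists (f' r).
Qed.

Lemma adjacency_preserving_fix0 f : bijective f -> adjacency_preserving f ->
    f 0 = 0 ->
  exists (h : F -> F) (g : V -> V),
    [/\ h 0 = 0, bijective h, bijective g, forall a u, f (a, u) = (h a, g u)
      & forall a b u v,
          symp_form (g u) (g v) = h a - h b <-> symp_form u v = a - b].
Proof.
move=> f_bij fadj f0; pose g u := (f (0, u)).2; pose H a u := (f (a, u)).1.
have fE a u : f (a, u) = (H a u, g u).
  rewrite [LHS]surjective_pairing; congr (_, _).
  exact: adjacency_preserving_fiber.
have gH a b u v :
    symp_form (g u) (g v) = H a u - H b v <-> symp_form u v = a - b.
  by rewrite -!adjacentE -!fE; apply: fadj.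
have [H00 g0] : H 0 0 = 0 /\ g 0 = 0 by rewrite /H /g f0.
(* Each [(0, u)] is adjacent to the origin, which is fixed. *)
have H0 u : H 0 u = 0.
  have /gH : symp_form u 0 = 0 - 0 by rewrite symp_form0r subr0.
  by rewrite g0 symp_form0r H00 subr0.
have Hu a u : H a u = H a 0.
  have /gH : symp_form u 0 = a - a by rewrite symp_form0r subrr.
  by rewrite g0 symp_form0r => /esym/subr0_eq.
exists (H^~ 0), g; case: f_bij => f' fK f'K; split=> //.
(* As [f] acts on the two coordinates separately, the inverses of both components are read off from
   [f'] on the axes. *)
- exists (fun c => (f' (c, 0)).1) => [a|c].
    by have := fK (a, 0); rewrite fE g0 => ->.
  have := f'K (c, 0); case: (f' _) => a u /=.
  by rewrite fE Hu => -[].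
- exists (fun y => (f' (0, y)).2) => [u|y].
    by have := fK (0, u); rewrite fE H0 => ->.
  by have := f'K (0, y); case: (f' _) => a u /=; rewrite fE => -[].
- by move=> a u; rewrite fE Hu.
- by move=> a b u v; have := gH a b u v; rewrite (Hu a u) (Hu b v).
Qed.

End PolarLines.

(** * Translations preserving [rho] *)

Section Translations.
Variables (F : fieldType) (m : nat).
Local Notation V := (symp_space F m).
Local Notation Y := (aff_point F m).

(* The inverse of the translation [(a, u) |-> (a + eta u w + b, u + w)]. *)
Definition untranslate (b : F) (w : V) (p : Y) : Y :=
  (p.1 - b - symp_form p.2 w, p.2 - w).

Lemma untranslate_bij b w : bijective (untranslate b w).
Proof.
exists (fun p : Y => (p.1 + symp_form p.2 w + b, p.2 + w)) => -[a u] /=;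
  rewrite /untranslate /= ?addrK ?subrK !symp_formE; congr (_, _).
  by rewrite subr0 !subrK.
by rewrite addr0 !addrK.
Qed.

(** The cross terms with [w] from expanding the form at the shifted vectors cancel against the
    corrections in the first coordinates. *)
Lemma rho_untranslate b w (p q : Y) :
  rho (untranslate b w p) (untranslate b w q) = rho p q.
Proof.
have subE (a c x y : F) : a - b - x - (c - b - y) = (a - c) - (x - y).
  by rewrite opprD addrACA -opprD (opprB c b) subrKA.
case: p q => [a u] [c v]; rewrite /rho /= !symp_formE (symp_formC w v) subE.
rewrite !opprK addr0 -(addrA _ _ (symp_form v w)) (addrC (- _)).
by rewrite -(opprB (symp_form u w)) (opprB (a - c)) subrKA.
Qed.

End Translations.

(** * From preservation of adjacency to a semilinear similitude *)

Section Semilinear.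
Variables (F : fieldType) (m : nat).
Local Notation V := (symp_space F m).

(** The nonzero [u0] makes every scalar a value of the form, so identities for [h] can be tested on
    pairs of vectors. *)
Lemma similitude_semilinear (h : F -> F) (g : V -> V) (u0 : V) :
    u0 != 0 -> h 0 = 0 -> bijective h -> bijective g ->
    (forall a b u v,
      symp_form (g u) (g v) = h a - h b <-> symp_form u v = a - b) ->
  exists (alpha : F) (sigma : {rmorphism F -> F})
         (phi : {linear V -> V | sigma \; *:%R}),
    [/\ alpha != 0, bijective sigma, h =1 (fun a => alpha * sigma a),
      g =1 phi
      & forall u v, symp_form (phi u) (phi v) = alpha * sigma (symp_form u v)].
Proof.
move=> u0N0 h0 h_bij g_bij hg; have [h' hK h'K] := h_bij.
have [g' gK g'K] := g_bij.
have gE u v : symp_form (g u) (g v) = h (symp_form u v).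
  have /hg -> : symp_form u v = symp_form u v - 0 by rewrite subr0.
  by rewrite h0 subr0.
have hB : {morph h : a b / a - b}.
  move=> a b; have [v v0] := symp_form_onto (a - b) u0N0.
  by have /hg := v0; rewrite gE v0.
have hN : {morph h : a / - a} by move=> a; rewrite -sub0r hB h0 sub0r.
have hD : {morph h : a b / a + b}.
  by move=> a b; rewrite -[b in LHS]opprK hB hN opprK.
(* As [g] is onto, nondegeneracy lets identities between vectors be checked by pairing with the
   image of [g], where [gE] turns them into identities for [h]. *)
have g_ext x y : (forall v, symp_form x (g v) = symp_form y (g v)) -> x = y.
  move=> xy; apply/subr0_eq/symp_form_nondeg => v.
  by rewrite -[v]g'K symp_formDl symp_formNl xy subrr.
have gD : {morph g : u v / u + v}.
  by move=> u v; apply: g_ext => x; rewrite symp_formDl !gE symp_formDl hD.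
have h1 : h 1 != 0 by rewrite -h0 (inj_eq (can_inj hK)) oner_eq0.
have hM k c : h (k * c) = h k * h c / h 1.
  have [v uv] := symp_form_onto 1 u0N0.
  (* [g (c *: v) - (h c / h 1) *: g v] is orthogonal to [g u0], hence, pulling
     back along [g] and scaling, to [g (k *: u0)]. *)
  pose t := g' (g (c *: v) - (h c / h 1) *: g v).
  have gt : g t = g (c *: v) - (h c / h 1) *: g v by rewrite /t g'K.
  have ut : symp_form u0 t = 0.
    apply: (can_inj hK); rewrite -gE gt symp_formDr symp_formNr symp_formZr !gE.
    by rewrite symp_formZr uv mulr1 mulfVK // subrr h0.
  have : symp_form (g (k *: u0)) (g t) = 0.
    by rewrite gE symp_formZl ut mulr0 h0.
  rewrite gt symp_formDr symp_formNr symp_formZr !gE !symp_formZl.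
  by rewrite symp_formZr uv !mulr1 => /subr0_eq ->; rewrite mulrC mulrA.
pose sigma a := h a / h 1.
have hE a : h a = h 1 * sigma a by rewrite mulrC mulfVK.
have sB : zmod_morphism sigma by move=> a b; rewrite /sigma hB mulrBl.
have sM : monoid_morphism sigma.
  by split=> [|a b]; rewrite /sigma ?divff // hM !mulrA (mulrAC (h a)).
pose sR : {rmorphism F -> F} := HB.pack sigma
  (GRing.isZmodMorphism.Build F F sigma sB)
  (GRing.isMonoidMorphism.Build F F sigma sM).
have gB : zmod_morphism g.
  by move=> u v; apply: (addIr (g v)); rewrite -gD !subrK.
have gZ : scalable_for (sR \; *:%R) g.
  move=> k u; apply: g_ext => v; rewrite symp_formZl !gE symp_formZl hM.
  by rewrite mulrAC.
pose gL : {linear V -> V | sR \; *:%R} := HB.pack g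
  (GRing.isZmodMorphism.Build V V g gB)
  (GRing.isScalable.Build F V V (sR \; *:%R) g gZ).
exists (h 1), sR, gL; split=> // [|u v]; last by rewrite gE hE.
(* Inverting [sigma] means undoing the division by [h 1] before applying the inverse of [h]. *)
exists (fun c => h' (h 1 * c)) => a /=; first by rewrite -hE hK.
by rewrite /sigma h'K mulrAC divff ?mul1r.
Qed.

End Semilinear.

(** * The maps of the stated form are automorphisms *)

Section Sufficiency.
Variables (F : fieldType) (m : nat).
Local Notation V := (symp_space F m).
Local Notation Y := (aff_point F m).
Variables (alpha b : F) (w : V) (sigma : {rmorphism F -> F}).
Variables (phi : {linear V -> V | sigma \; *:%R}) (f : Y -> Y).
Hypothesis alphaN0 : alpha != 0.
Hypotheses (sigma_bij : bijective sigma) (phi_bij : bijective phi).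
Hypothesis phiE : forall u v : V,
  symp_form (phi u) (phi v) = alpha * sigma (symp_form u v).
Hypothesis fE : forall a u,
  f (a, u) = (alpha * sigma a + symp_form (phi u) w + b, phi u + w).

Lemma semisimilitude_bij : bijective f.
Proof.
have [s' sK s'K] := sigma_bij; have [phi' phiK phi'K] := phi_bij.
exists (fun q => (s' ((q.1 - b - symp_form (q.2 - w) w) / alpha),
                  phi' (q.2 - w))) => -[a u] /=.
  by rewrite fE /= !addrK phiK mulrAC divff // mul1r sK.
by rewrite fE s'K phi'K mulrC mulfVK // !subrK.
Qed.

(** Removing the translation leaves [rho] unchanged and reduces [f] to [(alpha * sigma a, phi u)],
    which replaces [rho] by [alpha * sigma rho]; this vanishes only with [rho]. *)
Lemma semisimilitude_adjacency : adjacency_preserving f.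
Proof.
move=> p q; rewrite /adjacent -(rho_untranslate b w).
have fK a u : untranslate b w (f (a, u)) = (alpha * sigma a, phi u).
  by rewrite fE /untranslate /= !addrK symp_formDl symp_formxx addr0 addrK.
case: p q => [a u] [c v]; rewrite !fK /rho /= phiE -mulrBr -mulrBr -!rmorphB.
split=> [/eqP|->]; last by rewrite rmorph0 mulr0.
by rewrite mulf_eq0 fmorph_eq0 (negbTE alphaN0) => /eqP.
Qed.

(** The [sigma]-linear part of [f], which sends directions of lines to directions of their
    images. *)
Let dir (d : Y) : Y := (alpha * sigma d.1 + symp_form (phi d.2) w, phi d.2).

Lemma semisimilitude_line p d k : f (p + k *: d) = f p + sigma k *: dir d.
Proof.
case: p d => [a u] [c v]; rewrite !fE /dir /=; congr (_, _); last first.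
  by rewrite linearD linearZ /= addrAC.
rewrite linearD linearZ /= symp_formDl symp_formZl rmorphD rmorphM.
by rewrite mulrDr (mulrCA alpha) addrACA -mulrDr [LHS]addrAC.
Qed.

(** Being [sigma]-affine and bijective, [f] permutes the affine lines; preservation of adjacency
    both ways singles out the polar ones. *)
Lemma semisimilitude_polar_aut : polar_aut F m f.
Proof.
have f_bij := semisimilitude_bij; have f_adj := semisimilitude_adjacency.
have [f' fK f'K] := f_bij; have [s' sK s'K] := sigma_bij.
have dirE p d : dir d = f (p + d) - f p.
  have := semisimilitude_line p d 1; rewrite rmorph1 !scale1r => ->.
  by rewrite addrC addKr.
have imE p d : f @` [set p + k *: d | k in [set: F]] =
    [set f p + k *: dir d | k in [set: F]].
  rewrite eqEsubset; split=> x.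
    by case=> _ [k _ <-] <-; exists (sigma k); rewrite ?semisimilitude_line.
  case=> k _ <-; exists (p + s' k *: d); first by exists (s' k).
  by rewrite semisimilitude_line s'K.
split=> //; rewrite eqEsubset; split=> L.
  case=> L0 [/affine_linesP[p [d [dN0 L0E]]] L0adj] <-; split.
    apply/affine_linesP; exists (f p), (dir d); rewrite L0E imE; split=> //.
    rewrite (dirE p) subr_eq0 (inj_eq (can_inj fK)).
    by rewrite -subr_eq0 addrC addKr.
  by move=> _ _ [p1 Lp1 <-] [p2 Lp2 <-]; apply/f_adj/L0adj.
case=> /affine_linesP[p [d [dN0 LE]]] Ladj.
(* The preimage line is the one joining the preimages of the two points [p] and [p + d] of [L]. *)
pose p0 := f' p; pose d0 := f' (p + d) - p0.
have dE : dir d0 = d by rewrite (dirE p0) (addrC p0) subrK !f'K addrC addKr.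
have L0E : f @` [set p0 + k *: d0 | k in [set: F]] = L.
  by rewrite imE dE f'K LE.
exists [set p0 + k *: d0 | k in [set: F]] => //; split.
  apply/affine_linesP; exists p0, d0; split=> //.
  by rewrite subr_eq0 (inj_eq (can_inj f'K)) -subr_eq0 addrC addKr.
by move=> p1 p2 Lp1 Lp2; apply/f_adj/Ladj; rewrite -L0E; [exists p1 | exists p2].
Qed.

End Sufficiency.

(** * Equality of the two sets of maps *)

Theorem corollary3p6 (F : fieldType) (m : nat)
    (charF : 2%N \notin [pchar F]) (hm : (2 <= m)%N) :
  polar_aut F m =
  [set f : aff_point F m -> aff_point F m |
     exists (alpha b : F) (w : symp_space F m) (sigma : {rmorphism F -> F})
            (phi : {linear symp_space F m -> symp_space F m | sigma \; *:%R}),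
       [/\ alpha != 0,
           bijective sigma,
           bijective phi,
           forall u1 u2 : symp_space F m,
             symp_form (phi u1) (phi u2) = alpha * sigma (symp_form u1 u2)
         & forall (a : F) (u : symp_space F m),
             f (a, u) = (alpha * sigma a + symp_form (phi u) w + b, phi u + w)]].
Proof.
rewrite eqEsubset; split=> f; last first.
  case=> alpha [b [w [sigma [phi [aN0 s_bij phi_bij phiE fE]]]]].
  exact: (semisimilitude_polar_aut aN0 s_bij phi_bij phiE fE).
move=> f_aut; have [f_bij _] := f_aut.
(* The image of the origin determines the translation to be removed. *)
pose b := (f 0).1; pose w := (f 0).2.
have Tf_bij : bijective (untranslate b w \o f).
  by apply: bij_comp => //; apply: untranslate_bij.
have Tf_adj : adjacency_preserving (untranslate b w \o f).
  move=> p q; rewrite /adjacent /= rho_untranslate.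
  exact: polar_aut_adjacency.
have Tf0 : (untranslate b w \o f) 0 = 0.
  by rewrite /untranslate /= !subrr symp_formxx subr0.
have [h [g [h0 h_bij g_bij fE hg]]] :=
  adjacency_preserving_fix0 Tf_bij Tf_adj Tf0.
(* By [2 <= m] there is at least one coordinate, so the all-ones vector is nonzero. *)
have idx_gt0 : (0 < 2 * m - 2)%N by rewrite -(mulnBr 2 m 1) muln_gt0 subn_gt0.
have u0N0 : const_mx 1 != 0 :> symp_space F m.
  apply/eqP => /rowP/(_ (Ordinal idx_gt0)) /eqP.
  by rewrite !mxE oner_eq0.
have [alpha [sigma [phi [aN0 s_bij hE gE phiE]]]] :=
  similitude_semilinear u0N0 h0 h_bij g_bij hg.
exists alpha, b, w, sigma, phi; split=> //.
  exact: eq_bij gE.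
(* Undoing the translation puts the form of [phi u + w] with [w] into the first coordinate; this
   equals the form of [phi u] with [w], the form being alternating. *)
move=> a u; have := fE a u; rewrite /untranslate /= hE gE.
case: (f _) => c v /= [<- <-].
by rewrite !subrK symp_formDl symp_formNl symp_formxx subr0 !subrK.
Qed.
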